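(* Let $n\in\mathbb{N}\cup\{0\}$, let $q\neq 0$ and $\alpha$ be complex numbers. (i) The matrix $\left((q^{\alpha+1};q)_{j+k}\,q^{-\binom{j+k}{2}}\right)_{j,k=0}^{n}$ has determinant $$\det\left((q^{\alpha+1};q)_{j+k}\,q^{-\binom{j+k}{2}}\right)_{j,k=0}^{n}=\frac{\prod_{k=1}^{n}(q,q^{\alpha+1};q)_{k}}{q^{n(n+1)(4n-1)/6}}.$$ (ii) If $-\alpha\notin\mathbb{N}$ and $q^{k}\neq 1$ for every $k\in\mathbb{N}$, then this matrix is invertible, and its inverse matrix $(\gamma_{jk})_{j,k=0}^{n}$ has elements $$\gamma_{jk}=\frac{q^{j(j-1)+k(k-1)}}{(q^{\alpha+1};q)_{j}(q^{\alpha+1};q)_{k}}\sum_{m=\max(j,k)}^{n}\frac{(q^{\alpha+1};q)_{m}}{(q;q)_{m}}\left[\begin{array}{c}m\\ j\end{array}\right]_{q}\left[\begin{array}{c}m\\ k\end{array}\right]_{q}q^{m}.$$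
   Context: $\mathbb{N}=\{1,2,3,\dots\}$. For complex $x,p$ and an integer $m\ge 0$, $(x;p)_{m}:=\prod_{i=0}^{m-1}(1-xp^{i})$, with $(x;p)_0=1$. Also $(x_{1},\dots,x_{r};p)_{m}:=\prod_{i=1}^{r}(x_{i};p)_{m}$. For integers $0\le j\le m$, $\left[\begin{array}{c}m\\ j\end{array}\right]_{q}:=\frac{(q;q)_{m}}{(q;q)_{j}(q;q)_{m-j}}$. Powers of $q$ with non-integer exponent are $q^{s}=\exp(s\log q)$ for a fixed choice of $\log q$. $\binom{j+k}{2}=(j+k)(j+k-1)/2$. Matrices are indexed by $j,k=0,1,\dots,n$.
   Formalization: In (ii) the printed inverse has the wrong sign (already for n=1): the formal γ_{jk} carries an extra factor (-1)^{j+k}. Also assumed in (ii): for 1≤k≤n, q^{α+k}=1 only if α+k=0; otherwise the determinant in (i) is 0. *)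

(* Defs.v *)
From mathcomp Require Import all_boot all_order all_algebra.
From mathcomp Require Import complex.
From mathcomp Require Import all_classical all_reals all_analysis.

Set Implicit Arguments.
Unset Strict Implicit.
Unset Printing Implicit Defensive.

Import Order.TTheory GRing.Theory Num.Theory.
Local Open Scope ring_scope.

(* exp (x + iy) = e^x (cos y + i sin y) *)
Definition cexp (R : realType) (z : R[i]) : R[i] :=
  Complex (expR (complex.Re z) * cos (complex.Im z))
          (expR (complex.Re z) * sin (complex.Im z)).

(* q ^ s, where q enters only through the chosen value [logq] of its
   logarithm. *)
Definition cpow (R : realType) (logq s : R[i]) : R[i] := cexp (s * logq).

Definition qpoch (F : fieldType) (p x : F) (m : nat) : F :=
  \prod_(i < m) (1 - x * p ^+ i).

Definition qpochs (F : fieldType) (p : F) (xs : seq F) (m : nat) : F :=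
  \prod_(x <- xs) qpoch p x m.

(* Meaningful for j <= m, the only case used. *)
Definition qbinom (F : fieldType) (q : F) (m j : nat) : F :=
  qpoch q q m / (qpoch q q j * qpoch q q (m - j)%N).

Definition qhankel (F : fieldType) (q a : F) (n : nat) : 'M[F]_n.+1 :=
  \matrix_(j < n.+1, k < n.+1) (qpoch q a (j + k)%N / q ^+ 'C((j + k)%N, 2)).

(* The factor (-1) ^ (j + k) is necessary: for n = 1 the off-diagonal entries of
   the inverse of [qhankel] are - q / (1 - q). *)
Definition qhankel_inv (F : fieldType) (q a : F) (n : nat) : 'M[F]_n.+1 :=
  \matrix_(j < n.+1, k < n.+1)
    ((-1) ^+ (j + k)%N
     * (q ^+ (j * (j - 1) + k * (k - 1))%N / (qpoch q a j * qpoch q a k))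
     * \sum_(maxn j k <= m < n.+1)
         (qpoch q a m / qpoch q q m * qbinom q m j * qbinom q m k * q ^+ m)).

(* Main.v *)
Require Import Defs.
From mathcomp Require Import all_boot all_order all_algebra.
From mathcomp Require Import complex.
From mathcomp Require Import all_classical all_reals all_analysis.
From mathcomp Require Import ring zify.

(** Everything except the very last step is algebra over an arbitrary field,
    with [a] in the place of q^(alpha+1): the matrix is congruent to a diagonal
    one, and the congruence is explicit in both directions.

    The q-Vandermonde identity [q_vandermonde] expands (a q^j; q)_k as a sum over
    m of products of a factor depending on (j, m), one depending on (k, m) and
    one depending on m only, up to powers of q. Since
    'C(j + k, 2) = 'C(j, 2) + 'C(k, 2) + j k, the powers of q separate as well, so
    the matrix equals L D L^T with L lower triangular and D diagonal
    ([qhankel_LDL]). The diagonals of L and D give the determinant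
    ([det_qhankel]). Only powers of q are inverted here, and the Gaussian
    binomials are polynomials in q, so the formula also covers roots of unity
    and the values of [a] at which some (a; q)_k vanishes.

    When the factors (a; q)_j and (q; q)_j are nonzero, L has an inverse of the
    same kind up to a diagonal factor: with C_(m,j) a signed multiple of the
    Gaussian binomial [m j], the product C L is diagonal, because its entries
    off the diagonal are alternating sums that the q-binomial theorem evaluates
    to (1; q)_(m - i) = 0 ([hankelCL]). Hence C A C^T is diagonal, with inverse
    E say, and A^-1 = C^T E C, which written out is the announced sum over m.

    For complex q, the only analytic input is cexp (z + w) = cexp z * cexp w: it
    identifies q^(alpha+1) q^i with q^(alpha+i+1), whence (a; q)_j is nonzero. *)

Set Implicit Arguments.
Unset Strict Implicit.
Unset Printing Implicit Defensive.

Import Order.TTheory GRing.Theory Num.Theory.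
Local Open Scope ring_scope.

(** * Shifted factorials and Gaussian binomials *)

Section ShiftedFactorial.
Variables (F : fieldType) (q : F).
Implicit Types (a x : F) (i j k m n : nat).

Lemma qpoch0 x : qpoch q x 0 = 1.
Proof. by rewrite /qpoch big_ord0. Qed.

Lemma qpochSr x m : qpoch q x m.+1 = qpoch q x m * (1 - x * q ^+ m).
Proof. by rewrite /qpoch big_ord_recr. Qed.

Lemma qpochD x j k : qpoch q x (j + k) = qpoch q x j * qpoch q (x * q ^+ j) k.
Proof.
elim: k => [|k IH]; first by rewrite addn0 qpoch0 mulr1.
by rewrite addnS !qpochSr IH -!mulrA -exprD.
Qed.

Lemma qpochSl x m : qpoch q x m.+1 = (1 - x) * qpoch q (x * q) m.
Proof. by rewrite -add1n qpochD qpochSr qpoch0 expr0 expr1 mulr1 mul1r. Qed.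

Lemma qpoch1S m : qpoch q 1 m.+1 = 0.
Proof. by rewrite qpochSl subrr mul0r. Qed.

Lemma qpoch_neq0 x m :
  (forall i, (i < m)%N -> x * q ^+ i != 1) -> qpoch q x m != 0.
Proof.
move=> hx; apply/prodf_neq0 => i _.
by rewrite subr_eq0 eq_sym hx.
Qed.

(** The Gaussian binomial coefficient as a polynomial in q: the Pascal recursion
    keeps it meaningful at roots of unity, where the quotient of shifted
    factorials is not, and makes it vanish for n < k. *)
Fixpoint gauss n k : F :=
  match n, k with
  | _, 0 => 1
  | 0, _.+1 => 0
  | n'.+1, k'.+1 => gauss n' k'.+1 + q ^+ (n' - k') * gauss n' k'
  end.

Arguments gauss : simpl never.

Lemma gauss0 n : gauss n 0 = 1.
Proof. by case: n. Qed.

Lemma gaussS n k :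
  gauss n.+1 k.+1 = gauss n k.+1 + q ^+ (n - k) * gauss n k.
Proof. by []. Qed.

Lemma gauss_small n k : (n < k)%N -> gauss n k = 0.
Proof.
elim: n k => [|n IH] [|k] // lt_nk.
by rewrite gaussS !IH ?mulr0 ?addr0 // ltnW.
Qed.

Lemma gaussnn n : gauss n n = 1.
Proof.
elim: n => // n IH.
by rewrite gaussS IH gauss_small // subnn add0r mulr1.
Qed.

(** Both sides are (q; q)_n / ((q; q)_k (q; q)_(n-k-1)); the induction avoids the
    division. The middle step trades n.+1 for n at fixed k, again through the
    recursion and the induction hypothesis. *)
Lemma gauss_absorb n k : (k <= n)%N ->
  gauss n k.+1 * (1 - q ^+ k.+1) = gauss n k * (1 - q ^+ (n - k)).
Proof.
elim: n k => [|n IH] k le_kn.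
  have -> : k = 0%N by lia.
  by rewrite mul0r subnn expr0 subrr mulr0.
move: le_kn; rewrite leq_eqVlt => /orP[/eqP->|lt_kn].
  by rewrite gauss_small // mul0r subnn expr0 subrr mulr0.
have -> : gauss n.+1 k * (1 - q ^+ (n.+1 - k)) = gauss n k * (1 - q ^+ n.+1).
  case: k lt_kn => [|k] lt_kn; first by rewrite !gauss0 subn0.
  have IHk : gauss n k.+1 * (1 - q ^+ k.+1) = gauss n k * (1 - q ^+ (n - k)).
    by apply: IH; lia.
  have qn : q ^+ n.+1 = q ^+ k.+1 * q ^+ (n - k).
    by rewrite -exprD; congr (_ ^+ _); lia.
  have -> : (n.+1 - k.+1 = n - k)%N by lia.
  rewrite gaussS qn.
  transitivity (gauss n k.+1 * (1 - q ^+ (n - k))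
     + q ^+ (n - k) * (gauss n k * (1 - q ^+ (n - k)))); first by ring.
  by rewrite -IHk; ring.
have IHk := IH k lt_kn.
have qn : q ^+ n.+1 = q ^+ k.+1 * q ^+ (n - k).
  by rewrite -exprD; congr (_ ^+ _); lia.
rewrite gaussS mulrDl IHk qn; ring.
Qed.

Lemma gauss_absorbS n k : (k <= n)%N ->
  gauss n.+1 k.+1 * (1 - q ^+ k.+1) = gauss n k * (1 - q ^+ n.+1).
Proof.
move=> le_kn.
have qn : q ^+ n.+1 = q ^+ k.+1 * q ^+ (n - k).
  by rewrite -exprD; congr (_ ^+ _); lia.
rewrite gaussS mulrDl gauss_absorb // qn; ring.
Qed.

Lemma gauss_qpoch n k : (k <= n)%N ->
  gauss n k * (qpoch q q k * qpoch q q (n - k)) = qpoch q q n.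
Proof.
elim: n k => [|n IH] [|k] // le_kn; rewrite ?gauss0 ?qpoch0 ?subn0 ?mul1r //.
rewrite subSS (qpochSr q n) -(IH k) // (qpochSr q k) -!exprS.
transitivity (gauss n.+1 k.+1 * (1 - q ^+ k.+1)
              * (qpoch q q k * qpoch q q (n - k))); first by ring.
by rewrite gauss_absorbS //; ring.
Qed.

(** The recursion on [gauss] matches the factorisation
    (x; q)_(n+1) = (x; q)_n (1 - x q^n): its second summand produces the term
    - x q^n (x; q)_n. At x = 1 and n > 0 the sum vanishes, which is the
    orthogonality relation used to invert the triangular factor. *)
Theorem q_binomial x n :
  qpoch q x n = \sum_(s < n.+1) (-1) ^+ s * q ^+ 'C(s, 2) * gauss n s * x ^+ s.
Proof.
elim: n => [|n IH].
  by rewrite qpoch0 big_ord_recl big_ord0 /= !expr0 !mulr1 addr0.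
rewrite qpochSr big_ord_recl /=.
have -> : \sum_(i < n.+1) (-1) ^+ bump 0 i * q ^+ 'C(bump 0 i, 2)
            * gauss n.+1 (bump 0 i) * x ^+ bump 0 i
  = \sum_(i < n.+1) (-1) ^+ i.+1 * q ^+ 'C(i.+1, 2) * gauss n i.+1 * x ^+ i.+1
    - x * q ^+ n * qpoch q x n.
  rewrite IH mulr_sumr -sumrB; apply: eq_bigr => -[i /= lt_in] _.
  have qn : q ^+ n = q ^+ i * q ^+ (n - i) by rewrite -exprD; congr (_ ^+ _); lia.
  by rewrite /bump add1n binS bin1 exprD gaussS qn !exprS; ring.
have -> : \sum_(i < n.+1) (-1) ^+ i.+1 * q ^+ 'C(i.+1, 2) * gauss n i.+1 * x ^+ i.+1
   = qpoch q x n - 1.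
  rewrite IH big_ord_recr /= gauss_small // mulr0 mul0r addr0.
  by rewrite [in RHS]big_ord_recl /= gauss0 !expr0 !mulr1 addrAC subrr add0r.
by rewrite gauss0 !expr0; ring.
Qed.

(** Induction on j with [a] replaced by [a * q]. After expanding gauss j.+1 by the
    recursion, the coefficients of gauss j m on both sides agree term by term:
    with [gauss_absorb] this reduces to
    q^(k-m) (1 - a q^m) + (1 - q^(k-m)) = 1 - a q^k.
    The range of m is any interval containing 0..k, so that in the matrix
    factorisation all the entries share the same range. *)
Theorem q_vandermonde a j k N : (k <= N)%N ->
  qpoch q (a * q ^+ j) k =
  \sum_(m < N.+1) gauss j m * (gauss k m * qpoch q q m
     * q ^+ ((j - m) * (k - m)) * qpoch q (a * q ^+ m) (k - m)).
Proof.
move=> le_kN; elim: j a => [|j IH] a.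
  rewrite big_ord_recl big1 => [|i _]; last first.
    by rewrite gauss_small // mul0r.
  by rewrite /= !gauss0 qpoch0 sub0n mul0n !expr0 subn0 !mulr1 !mul1r addr0.
rewrite exprS mulrA IH.
(* The factor of gauss j.+1 m in the sum to be reached. *)
pose u m := gauss k m * qpoch q q m
     * q ^+ ((j.+1 - m) * (k - m)) * qpoch q (a * q ^+ m) (k - m).
transitivity (\sum_(m < N.+1) gauss j m * u m
   + \sum_(m < N.+1) q ^+ (j - m) * gauss j m * u m.+1).
  rewrite -big_split /=; apply: eq_bigr => -[m /= _] _.
  have [lt_jm|le_mj] := ltnP j m.
    by rewrite gauss_small // mulr0 !mul0r addr0.
  rewrite [q ^+ (j - m) * _]mulrC -[X in _ + X]mulrA -mulrDr.
  congr (_ * _); rewrite /u.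
  have [lt_km|le_mk] := ltnP k m.
    by rewrite !(@gauss_small k) ?(leqW lt_km) // !mul0r mulr0 addr0.
  move: le_mk; rewrite leq_eqVlt => /orP[/eqP->|lt_mk].
    by rewrite (@gauss_small k k.+1) // !subnn !muln0 !expr0 !qpoch0; ring.
  (* The common factor of the three terms contains (a q^(m+1); q)_(k-m-1). *)
  have kmE : (k - m = (k - m.+1).+1)%N by lia.
  have absorb := gauss_absorb (ltnW lt_mk).
  have qk : q ^+ (k - m) * q ^+ m = q ^+ m * q ^+ (k - m.+1) * q.
    by rewrite kmE exprS; ring.
  have -> : ((j.+1 - m) * (k - m) = (k - m) + (j - m) * (k - m))%N by nia.
  have eqj : q ^+ ((j - m) * (k - m))
      = q ^+ (j - m) * q ^+ ((j.+1 - m.+1) * (k - m.+1)).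
    by rewrite -exprD; congr (_ ^+ _); nia.
  rewrite exprD eqj (qpochSr q m) -exprS.
  have -> : qpoch q (a * q * q ^+ m) (k - m)
     = qpoch q (a * q ^+ m.+1) (k - m.+1) * (1 - a * (q ^+ (k - m) * q ^+ m)).
    by rewrite qk kmE qpochSr exprS; congr (qpoch _ _ _ * _); ring.
  have -> : qpoch q (a * q ^+ m) (k - m)
     = (1 - a * q ^+ m) * qpoch q (a * q ^+ m.+1) (k - m.+1).
    by rewrite {1}kmE qpochSl exprSr mulrA.
  set Q := q ^+ (j - m); set Q' := q ^+ (_ * _).
  set P := qpoch q (a * q ^+ m.+1) _.
  transitivity (gauss k m * qpoch q q m * (q ^+ (k - m) * (Q * Q'))
       * ((1 - a * q ^+ m) * P)
     + Q * (gauss k m.+1 * (1 - q ^+ m.+1)) * qpoch q q m * Q' * P); last by ring.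
  by rewrite absorb; ring.
rewrite big_ord_recl [X in _ = X]big_ord_recl -addrA; congr (_ + _).
  by rewrite /u /= !gauss0.
rewrite [X in _ + X]big_ord_recr /= {3}/u (@gauss_small k N.+1) // !mul0r.
rewrite mulr0 addr0 -big_split /=; apply: eq_bigr => -[m /= _] _.
by rewrite /bump add1n mulrDl.
Qed.

End ShiftedFactorial.

(** * The triangular factorisation, the determinant and the inverse *)

Section Factorisation.
Variables (F : fieldType) (q a : F) (n : nat).
Hypothesis q_neq0 : q != 0.

(** The exponent of q collects, of (j - m)(k - m) - 'C(j + k, 2), the part
    depending on j and m; what is left over is the m * m in [hankelD]. *)
Definition hankelL : 'M[F]_n.+1 := \matrix_(j, m)
  (gauss q j m * qpoch q (a * q ^+ m) (j - m) / q ^+ ('C(j, 2) + m * j)).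

Definition hankelD : 'rV[F]_n.+1 :=
  \row_m (qpoch q a m * qpoch q q m * q ^+ (m * m)).

Lemma bin2D (j k : nat) : 'C(j + k, 2) = ('C(j, 2) + 'C(k, 2) + j * k)%N.
Proof.
elim: k => [|k IH]; first by rewrite addn0 bin0n muln0 !addn0.
by rewrite addnS !binS !bin1 IH; lia.
Qed.

Lemma qhankel_LDL : qhankel q a n = hankelL *m diag_mx hankelD *m hankelL^T.
Proof.
apply/matrixP=> j k; rewrite !mxE qpochD (@q_vandermonde _ _ _ _ _ n); last first.
  by rewrite -ltnS.
rewrite mulr_sumr mulr_suml; apply: eq_bigr => m _.
rewrite mul_mx_diag !mxE.
have [lt_jm|le_mj] := ltnP j m.
  by rewrite gauss_small // !(mul0r, mulr0).
have [lt_km|le_mk] := ltnP k m.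
  by rewrite (@gauss_small _ _ k) // !(mul0r, mulr0).
have -> : qpoch q a j = qpoch q a m * qpoch q (a * q ^+ m) (j - m).
  by rewrite -qpochD subnKC.
have expE : q ^+ ('C(j, 2) + m * j) * q ^+ ('C(k, 2) + m * k)
    * q ^+ ((j - m) * (k - m)) = q ^+ (m * m) * q ^+ 'C(j + k, 2).
  rewrite -!exprD; congr (_ ^+ _).
  have := bin2D j k; nia.
have ej : q ^+ ('C(j, 2) + m * j) != 0 by rewrite expf_neq0.
have ek : q ^+ ('C(k, 2) + m * k) != 0 by rewrite expf_neq0.
have ejk : q ^+ 'C(j + k, 2) != 0 by rewrite expf_neq0.
have -> : q ^+ (m * m) = q ^+ ('C(j, 2) + m * j) * q ^+ ('C(k, 2) + m * k)
    * q ^+ ((j - m) * (k - m)) / q ^+ 'C(j + k, 2).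
  by rewrite expE mulfK.
by field; rewrite ?ej ?ek ?ejk.
Qed.


(** Left as a product over m: the powers of q are
    m^2 - 2 ('C(m, 2) + m^2) = - m (2m - 1). *)
Lemma det_qhankel :
  \det (qhankel q a n)
    = \prod_(m < n.+1) (qpoch q a m * qpoch q q m / q ^+ (m * (2 * m - 1))).
Proof.
rewrite qhankel_LDL !det_mulmx det_tr det_diag det_trig; last first.
  by apply/is_trig_mxP => j m lt_jm; rewrite mxE gauss_small // !mul0r.
rewrite -!big_split /=; apply: eq_bigr => m _.
rewrite !mxE gaussnn subnn qpoch0 !mul1r.
have expE : q ^+ ('C(m, 2) + m * m) * q ^+ ('C(m, 2) + m * m)
    = q ^+ (m * m) * q ^+ (m * (2 * m - 1)).
  rewrite -!exprD; congr (_ ^+ _).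
  have := bin2D m m; rewrite bin2; nia.
have em : q ^+ (m * m) != 0 by rewrite expf_neq0.
have en : q ^+ (m * (2 * m - 1)) != 0 by rewrite expf_neq0.
have ej : q ^+ ('C(m, 2) + m * m) != 0 by rewrite expf_neq0.
apply: (mulIf (mulf_neq0 ej ej)).
transitivity (qpoch q a m * qpoch q q m * q ^+ (m * m)).
  by field.
by rewrite expE; field.
Qed.

(** The inverse of [hankelL], up to a diagonal factor on the left. *)
Definition hankelC : 'M[F]_n.+1 := \matrix_(m, j)
  ((-1) ^+ j * q ^+ (j * (j - 1)) * gauss q m j / qpoch q a j).

Definition hankelE : 'rV[F]_n.+1 :=
  \row_m (qpoch q a m / qpoch q q m * q ^+ m).

Hypothesis qpoch_a_neq0 : forall j, (j <= n)%N -> qpoch q a j != 0.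
Hypothesis qpoch_q_neq0 : forall j, (j <= n)%N -> qpoch q q j != 0.

Lemma qbinomE m j : (j <= m <= n)%N -> qbinom q m j = gauss q m j.
Proof.
case/andP=> le_jm le_mn; rewrite /qbinom -(gauss_qpoch q le_jm).
by rewrite mulfK // mulf_neq0 // qpoch_q_neq0 //; lia.
Qed.

(** The terms with m < max (j, k), absent from the sum in [qhankel_inv], are
    those where a Gaussian binomial vanishes, so that sum is a matrix product. *)
Lemma qhankel_invE :
  qhankel_inv q a n = hankelC^T *m diag_mx hankelE *m hankelC.
Proof.
apply/matrixP=> j k; rewrite !mxE mulr_sumr.
rewrite (@big_nat_widenl _ _ _ _ 0) // big_mkord big_mkcond /=.
apply: eq_bigr => m _; rewrite mul_mx_diag !mxE geq_max.
case: ifP => [/andP[le_jm le_km]|].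
  have le_mn : (m <= n)%N by rewrite -ltnS.
  rewrite !qbinomE ?le_jm ?le_km //.
  have aj : qpoch q a j != 0 by apply: qpoch_a_neq0; lia.
  have ak : qpoch q a k != 0 by apply: qpoch_a_neq0; lia.
  have qm : qpoch q q m != 0 by apply: qpoch_q_neq0.
  by rewrite !exprD; field; rewrite aj ak qm.
move/negbT; rewrite negb_and -!ltnNge => /orP[lt_mj|lt_mk].
  by rewrite (gauss_small _ lt_mj) !(mul0r, mulr0).
by rewrite (gauss_small _ lt_mk) !(mul0r, mulr0).
Qed.

Lemma gauss_mul m j i : (i <= j)%N -> (j <= m)%N -> (m <= n)%N ->
  gauss q m j * gauss q j i = gauss q m i * gauss q (m - i) (j - i).
Proof.
move=> le_ij le_jm le_mn.
have le_im := leq_trans le_ij le_jm.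
have qnz k : (k <= m)%N -> qpoch q q k != 0.
  by move=> le_km; apply: qpoch_q_neq0; lia.
have le_jim : (j - i <= m - i)%N by lia.
have := gauss_qpoch q le_jim.
have -> : (m - i - (j - i) = m - j)%N by lia.
have := gauss_qpoch q le_im; have := gauss_qpoch q le_jm.
have := gauss_qpoch q le_ij.
move=> eji emj emi eji'.
have nz : qpoch q q i * qpoch q q (j - i) * qpoch q q (m - j) != 0.
  by rewrite !mulf_neq0 // qnz //; lia.
apply: (mulIf nz).
transitivity (qpoch q q m).
  by rewrite -emj -eji; ring.
by rewrite -emi -eji'; ring.
Qed.

(** Inversion of the triangular factor: by [gauss_mul] the entry (m, i) is
    gauss m i times a sum over s = j - i which the q-binomial theorem at x = 1
    identifies as (1; q)_(m - i). *)
Lemma hankelCL : hankelC *m hankelL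
  = diag_mx (\row_i ((-1) ^+ i * q ^+ 'C(i, 2) / q ^+ (i * i) / qpoch q a i)).
Proof.
apply/matrixP=> m i; rewrite !mxE.
have le_mn : (m <= n)%N by rewrite -ltnS.
have le_in : (i <= n)%N by rewrite -ltnS.
have [lt_mi|le_im] := ltnP m i.
  rewrite eq_sym -val_eqE gtn_eqF //= mulr0n big1 // => j _; rewrite !mxE.
  have [lt_mj|le_jm] := ltnP m j.
    by rewrite (gauss_small _ lt_mj) !(mul0r, mulr0).
  by rewrite (@gauss_small _ _ j i) ?(leq_ltn_trans le_jm) // !(mul0r, mulr0).
transitivity ((-1) ^+ i * q ^+ 'C(i, 2) / q ^+ (i * i) / qpoch q a i
   * gauss q m i * qpoch q 1 (m - i)); last first.
  have [->|neq_mi] := eqVneq m i.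
    by rewrite subnn qpoch0 gaussnn !mulr1 mulr1n.
  have -> : (m - i = (m - i).-1.+1)%N by move: neq_mi; rewrite -val_eqE /=; lia.
  by rewrite qpoch1S mulr0 mulr0n.
rewrite (q_binomial q 1) mulr_sumr.
transitivity (\sum_(i <= j < m.+1)
   (-1) ^+ j * q ^+ (j * (j - 1)) * gauss q m j / qpoch q a j *
   (gauss q j i * qpoch q (a * q ^+ i) (j - i) / q ^+ ('C(j, 2) + i * j))).
  rewrite [RHS](@big_nat_widen _ _ _ _ _ n.+1) //.
  rewrite [RHS](@big_nat_widenl _ _ _ _ 0) //.
  rewrite big_mkord [RHS]big_mkcond /=; apply: eq_bigr => j _; rewrite !mxE.
  case: ifP => // /negbT; rewrite negb_and -!ltnNge ltnS.
  case/orP=> [lt_mj|lt_ji].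
    by rewrite (gauss_small _ lt_mj) !(mul0r, mulr0).
  by rewrite (gauss_small _ lt_ji) !(mul0r, mulr0).
rewrite -{1}[i : nat]add0n big_addn big_mkord subSn //.
apply: eq_bigr => -[s /= lt_s] _; rewrite expr1n mulr1 addnK.
have ai : qpoch q a i != 0 by apply: qpoch_a_neq0.
have ai' : qpoch q (a * q ^+ i) s != 0.
  have : qpoch q a (i + s) != 0 by apply: qpoch_a_neq0; lia.
  by rewrite qpochD mulf_eq0 negb_or => /andP[].
have gE : gauss q m (s + i) * gauss q (s + i) i = gauss q m i * gauss q (m - i) s.
  by rewrite gauss_mul ?addnK //; lia.
have e1 : q ^+ (i * i) != 0 by rewrite expf_neq0.
have e2 : q ^+ ('C(s + i, 2) + i * (s + i)) != 0 by rewrite expf_neq0.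
have expE : q ^+ ((s + i) * (s + i - 1)) * q ^+ (i * i)
  = q ^+ ('C(s + i, 2) + i * (s + i)) * q ^+ 'C(i, 2) * q ^+ 'C(s, 2).
  rewrite -!exprD; congr (_ ^+ _).
  have := bin2D (s + i) (s + i); have := bin2D s i.
  by rewrite (bin2 (_ + (s + i))); nia.
rewrite (addnC s i) qpochD (addnC i s).
transitivity ((-1) ^+ s * (-1) ^+ i * (q ^+ ((s + i) * (s + i - 1)) * q ^+ (i * i))
  * (gauss q m (s + i) * gauss q (s + i) i) / qpoch q a i
  / q ^+ (i * i) / q ^+ ('C(s + i, 2) + i * (s + i))).
  by rewrite exprD; field; rewrite ?e1 ?e2 ?ai ?ai'.
by rewrite gE expE; field; rewrite ?e1 ?e2 ?ai ?ai'.
Qed.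

(** C A C^T = (C L) D (C L)^T is the inverse of E; moving C^T to the front turns
    E (C A C^T) = 1 into (C^T E C) A = 1. *)
Lemma qhankel_inv_mul : qhankel_inv q a n *m qhankel q a n = 1%:M.
Proof.
have diagM : diag_mx hankelE *m (hankelC *m qhankel q a n *m hankelC^T) = 1%:M.
  rewrite qhankel_LDL !mulmxA -(mulmxA _ hankelC) hankelCL -(mulmxA _ hankelL^T).
  rewrite -trmx_mul hankelCL tr_diag_mx !mulmx_diag -diag_const_mx.
  congr diag_mx; apply/rowP=> m; rewrite !mxE.
  have le_mn : (m <= n)%N by rewrite -ltnS.
  have am : qpoch q a m != 0 by apply: qpoch_a_neq0.
  have qm : qpoch q q m != 0 by apply: qpoch_q_neq0.
  have em : q ^+ (m * m) != 0 by rewrite expf_neq0.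
  have expE : q ^+ m * q ^+ 'C(m, 2) * q ^+ 'C(m, 2) = q ^+ (m * m).
    rewrite -!exprD; congr (_ ^+ _); have := bin2D m m; rewrite bin2; nia.
  transitivity (((-1) ^+ m * (-1) ^+ m)
     * (q ^+ m * q ^+ 'C(m, 2) * q ^+ 'C(m, 2)) / q ^+ (m * m)).
    by field; rewrite ?am ?qm ?em.
  by rewrite expE mulfK // -expr2 sqrr_sign.
rewrite qhankel_invE -!mulmxA; apply: mulmx1C.
by rewrite -!mulmxA in diagM *.
Qed.

End Factorisation.

(** * Complex powers of q *)

Section ComplexPower.
Variable R : realType.
Implicit Types l s z w : R[i].

Lemma cexpD z w : cexp (z + w) = cexp z * cexp w.
Proof.
case: z w => [x y] [x' y']; rewrite /cexp /= expRD cosD sinD.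
by apply/eqP; rewrite eq_complex /=; apply/andP; split; apply/eqP; ring.
Qed.

Lemma cpowD_nat l s k : cpow l (s + k%:R) = cpow l s * cexp l ^+ k.
Proof.
rewrite /cpow; elim: k => [|k IH]; first by rewrite addr0 expr0 mulr1.
by rewrite -natr1 addrA mulrDl mul1r cexpD IH exprSr mulrA.
Qed.

End ComplexPower.

(** At n = 0 the truncated subtraction in 4 * n - 1 is harmless, the product
    being 0 anyway. *)
Lemma sum_exponent n :
  ((n * (n + 1) * (4 * n - 1)) %/ 6 = \sum_(m < n.+1) m * (2 * m - 1))%N.
Proof.
have -> : (n * (n + 1) * (4 * n - 1) = (\sum_(m < n.+1) m * (2 * m - 1)) * 6)%N.
  elim: n => [|n IH]; first by rewrite big_ord_recr big_ord0.
  by rewrite big_ord_recr /= mulnDl -IH; nia.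
by rewrite mulnK.
Qed.

Theorem theorem2p3 (R : realType) (n : nat) (q alpha logq : R[i])
    (hq : q != 0) (hlogq : cexp logq = q) :
  let a := cpow logq (alpha + 1) in
  \det (qhankel q a n)
    = (\prod_(1 <= k < n.+1) qpochs q [:: q; a] k)
        / q ^+ ((n * (n + 1) * (4 * n - 1)) %/ 6)%N
  /\
  ((forall k : nat, (1 <= k)%N -> - alpha != k%:R) ->
   (forall k : nat, (1 <= k <= n)%N ->
      cpow logq (alpha + k%:R) = 1 -> alpha + k%:R = 0) ->
   (forall k : nat, (1 <= k)%N -> q ^+ k != 1) ->
   qhankel q a n \in unitmx /\
   invmx (qhankel q a n) = qhankel_inv q a n).
Proof.
move=> a; split.
  rewrite det_qhankel // sum_exponent expr_sum big_add1 big_mkord -prodfV.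
  rewrite big_split /= -[X in X * _]mul1r; congr (_ * _).
  rewrite big_ord_recl !qpoch0 !mul1r; apply: eq_bigr => k _.
  by rewrite /qpochs !big_cons big_nil mulr1 mulrC.
move=> alphaN cpow1 q1.
have qa j : (j <= n)%N -> qpoch q a j != 0.
  move=> le_jn; apply: qpoch_neq0 => i lt_ij.
  rewrite /a -hlogq -cpowD_nat -addrA nat1r.
  apply/eqP=> /cpow1 h.
  have /h/eqP : (1 <= i.+1 <= n)%N by lia.
  by rewrite addr_eq0 -eqr_oppLR (negPf (alphaN _ _)).
have qq j : (j <= n)%N -> qpoch q q j != 0.
  by move=> _; apply: qpoch_neq0 => i _; rewrite -exprS q1.
have invM := qhankel_inv_mul hq qa qq.
have [_ unitH] := mulmx1_unit invM.
split=> //.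
by rewrite -[RHS]mulmx1 -(mulmxV unitH) mulmxA invM mul1mx.
Qed.
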